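(* Let $C$ be a doubly even binary linear code with factor set $\phi$, and let $L(\phi)$ be the corresponding code loop. Then the following statements are true: (1) $L(\phi)$ is a C-loop (central loop); (2) $L(\phi)$ is a CC-loop (conjugacy closed loop); (3) $L(\phi)$ is a Burn loop; (4) $L(\phi)$ is an extra loop.
   Context: Let $F=\mathbb{Z}_2=\{0,1\}$ be the field of two elements and $V=F^n$ a finite-dimensional vector space over $F$. A binary linear code is a subspace $C\le V$. For $u,v,w\in C$, $\|u\|$ is the number of non-zero coordinates of $u$; $u\cdot v$ is the number of coordinates in which both $u$ and $v$ are non-zero; $c(u,v,w)$ is the number of coordinates in which $u$, $v$ and $w$ are all non-zero (all non-negative integers). $C$ is doubly even if for all $u,v\in C$, $u\cdot v$ is even and $\|u\|$ is divisible by $4$. A factor set on such a $C$ is a map $\phi:C\times C\to F$ such that for all $u,v,w\in C$: $\phi(u,u)\equiv \|u\|/4 \pmod 2$; $\phi(u,v)+\phi(v,u)\equiv (u\cdot v)/2 \pmod 2$; $\phi(u,v)+\phi(u+v,w)+\phi(v,w)+\phi(u,v+w)\equiv c(u,v,w)\pmod 2$. (One has $\phi(u,0)=\phi(0,u)=0$.) The code loop $L(\phi)$ is the loop with underlying set $F\times C$ and operation $(a,u)\ast(b,v)=(a+b+\phi(u,v),\,u+v)$. Definitions for a loop: it is an LC-loop if $(xx)(yz)=(x(xy))z$, an RC-loop if $(yz)(xx)=y((zx)x)$ (for all $x,y,z$), and a C-loop (central loop) if it is both LC and RC, equivalently $y(x(xz))=((yx)x)z$ for all $x,y,z$. It is left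 conjugacy closed (LCC) if for all $x,y$ the map $L_xL_yL_x^{-1}$ is a left translation, where $L_x(y)=xy$; right conjugacy closed (RCC) if for all $x,y$ the map $R_xR_yR_x^{-1}$ is a right translation, where $R_x(y)=yx$; a CC-loop if it is both LCC and RCC. It is Moufang if $(xy)(zx)=(x(yz))x$ for all $x,y,z$. It is a Burn loop if it is both a Moufang loop and a CC-loop. It is an extra loop if $((xy)z)x=x(y(zx))$ for all $x,y,z$. *)

(* Defs.v *)
From HB Require Import structures.
From mathcomp Require Import all_boot all_algebra.

Set Implicit Arguments.
Unset Strict Implicit.
Unset Printing Implicit Defensive.

Import GRing.Theory.

(* A loop is a unital magma whose translations are all invertible; the inverse
   of [y |-> x * y] is [ldiv x] and the inverse of [y |-> y * x] is
   [fun y => rdiv y x]. *)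
HB.mixin Record UMagma_isLoop T of UMagma T := {
  ldiv : T -> T -> T;
  rdiv : T -> T -> T;
  ldivK : forall x : T, cancel ( *%g x) (ldiv x);
  mulKldiv : forall x : T, cancel (ldiv x) ( *%g x);
  rdivK : forall x : T, cancel (fun y => (y * x)%g) (fun y => rdiv y x);
  mulKrdiv : forall x : T, cancel (fun y => rdiv y x) (fun y => (y * x)%g)
}.

#[short(type="loopType")]
HB.structure Definition Loop := {T of UMagma_isLoop T & UMagma T}.

Section LoopClasses.
Local Open Scope group_scope.
Variable L : loopType.
Implicit Types x y z : L.

Definition ltrans x : L -> L := fun y => x * y.
Definition rtrans x : L -> L := fun y => y * x.
Definition ltrans_inv x : L -> L := fun y => ldiv x y.
Definition rtrans_inv x : L -> L := fun y => rdiv y x.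

Definition LC_loop := forall x y z, (x * x) * (y * z) = (x * (x * y)) * z.
Definition RC_loop := forall x y z, (y * z) * (x * x) = y * ((z * x) * x).
Definition C_loop := LC_loop /\ RC_loop.

(* Maps are composed as functions: the rightmost factor acts first. *)
Definition LCC_loop :=
  forall x y, exists z, ltrans x \o ltrans y \o ltrans_inv x =1 ltrans z.
Definition RCC_loop :=
  forall x y, exists z, rtrans x \o rtrans y \o rtrans_inv x =1 rtrans z.
Definition CC_loop := LCC_loop /\ RCC_loop.

Definition Moufang_loop := forall x y z, (x * y) * (z * x) = (x * (y * z)) * x.
Definition Burn_loop := Moufang_loop /\ CC_loop.
Definition extra_loop := forall x y z, ((x * y) * z) * x = x * (y * (z * x)).

End LoopClasses.

Local Open Scope ring_scope.

Section BinaryCodes.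
Variable n : nat.
Implicit Types u v w : 'rV['F_2]_n.

Definition weight u : nat := #|[set i | u 0 i != 0]|.
Definition common2 u v : nat := #|[set i | (u 0 i != 0) && (v 0 i != 0)]|.
Definition common3 u v w : nat :=
  #|[set i | [&& u 0 i != 0, v 0 i != 0 & w 0 i != 0]]|.

Definition doubly_even (C : {vspace 'rV['F_2]_n}) :=
  forall u v, u \in C -> v \in C ->
    (2 %| common2 u v)%N /\ (4 %| weight u)%N.

(* Congruences modulo 2 are equalities in 'F_2, through [_%:R]. *)
Record factor_set (C : {vspace 'rV['F_2]_n})
    (phi : subvs_of C -> subvs_of C -> 'F_2) : Prop := FactorSet {
  factor_set_diag : forall u : subvs_of C,
    phi u u = (weight (vsval u) %/ 4)%N%:R;
  factor_set_comm : forall u v : subvs_of C,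
    phi u v + phi v u = (common2 (vsval u) (vsval v) %/ 2)%N%:R;
  factor_set_assoc : forall u v w : subvs_of C,
    phi u v + phi (u + v) w + phi v w + phi u (v + w)
      = (common3 (vsval u) (vsval v) (vsval w))%:R
}.

End BinaryCodes.

Lemma addFF (x : 'F_2) : x + x = 0.
Proof. by rewrite -mulr2n -mulr_natr (_ : 2%:R = 0) ?mulr0 //; apply: val_inj. Qed.

Section CodeLoop.
Variables (n : nat) (C : {vspace 'rV['F_2]_n}).
Variable phi : subvs_of C -> subvs_of C -> 'F_2.
Hypothesis phiP : factor_set phi.

Lemma weight0 : weight (0 : 'rV['F_2]_n) = 0%N.
Proof. by apply: eq_card0 => i; rewrite !inE mxE eqxx. Qed.

Lemma factor_set00 : phi 0 0 = 0.
Proof. by rewrite (factor_set_diag phiP) linear0 weight0. Qed.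

Lemma factor_set_r0 u : phi u 0 = 0.
Proof.
have := factor_set_assoc phiP u 0 0.
rewrite !addr0 factor_set00 addr0 addFF add0r => ->.
by rewrite /common3 eq_card0 // => i; rewrite !inE linear0 mxE eqxx andbF.
Qed.

Lemma factor_set_0l u : phi 0 u = 0.
Proof.
have := factor_set_assoc phiP 0 0 u.
rewrite !add0r factor_set00 add0r addFF add0r => ->.
by rewrite /common3 eq_card0 // => i; rewrite !inE linear0 mxE eqxx.
Qed.

(* A copy of F * C that depends on the proof of the factor set conditions, so
   that the loop structure can be attached to it canonically. *)
Definition code_loop of factor_set phi : Type := ('F_2 * subvs_of C)%type.

Local Notation T := (code_loop phiP).

HB.instance Definition _ := Choice.copy T ('F_2 * subvs_of C)%type.

Definition code_mul (x y : T) : T := (x.1 + y.1 + phi x.2 y.2, x.2 + y.2).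
Definition code_one : T := (0, 0).
Definition code_ldiv (x y : T) : T :=
  (y.1 - x.1 - phi x.2 (y.2 - x.2), y.2 - x.2).
Definition code_rdiv (y x : T) : T :=
  (y.1 - x.1 - phi (y.2 - x.2) x.2, y.2 - x.2).

Lemma code_mul1x : left_id code_one code_mul.
Proof. by case=> a u; rewrite /code_mul /= factor_set_0l !add0r addr0. Qed.

Lemma code_mulx1 : right_id code_one code_mul.
Proof. by case=> a u; rewrite /code_mul /= factor_set_r0 !addr0. Qed.

Lemma code_ldivK x : cancel (code_mul x) (code_ldiv x).
Proof.
by case: x => a u [b v]; rewrite /code_mul /code_ldiv /= [u + v]addrC addrK
  addrAC addrK [a + b]addrC addrK.
Qed.

Lemma code_mulKldiv x : cancel (code_ldiv x) (code_mul x).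
Proof.
by case: x => a u [b v]; rewrite /code_mul /code_ldiv /= [u + _]addrC subrK
  addrA addrNK [a + _]addrC subrK.
Qed.

Lemma code_rdivK x : cancel (code_mul^~ x) (code_rdiv^~ x).
Proof.
by case: x => a u [b v]; rewrite /code_mul /code_rdiv /= addrK addrAC addrK addrK.
Qed.

Lemma code_mulKrdiv x : cancel (code_rdiv^~ x) (code_mul^~ x).
Proof.
case: x => a u [b v]; rewrite /code_mul /code_rdiv /= subrK.
by rewrite addrAC subrK subrK.
Qed.

HB.instance Definition _ := hasMul.Build T code_mul.
HB.instance Definition _ := Magma_isUMagma.Build T code_mul1x code_mulx1.
HB.instance Definition _ :=
  UMagma_isLoop.Build T code_ldivK code_mulKldiv code_rdivK code_mulKrdiv.

End CodeLoop.

(* Main.v *)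
Require Import Defs.
From mathcomp Require Import all_boot all_algebra.

(** The code loop is a central extension of the elementary abelian 2-group [C]
by [F_2], and the whole proof rests on the shape of its associator.  The
cocycle condition on [phi] says that [(x y) z] and [x (y z)] differ by the
central element [c(u, v, w)], where [u], [v], [w] are the components of [x],
[y], [z] in [C] ([code_mulA]).  Modulo 2, [c(u, v, w)] is the sum over the
coordinates of [u_i v_i w_i], hence a symmetric trilinear form ([triple]); since
[c(u, u, w)] is the number of common coordinates of [u] and [w], which is even
for a doubly even code, the form is alternating on [C].

Each identity compares two bracketings of one product, so rebracketing one side
into the other only collects values of this form, and trilinearity,
symmetry and alternation make them cancel in [F_2].  For conjugacy closedness
the element whose translation is the conjugate of the translation by [y]
is itself a conjugate of [y] by [x]; it has the same component in [C] as [y],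
because [C] is commutative, so the same bookkeeping applies. *)

Set Implicit Arguments.
Unset Strict Implicit.
Unset Printing Implicit Defensive.

Import GRing.Theory.
Local Open Scope ring_scope.

Section Triple.
Variable n : nat.
Implicit Types u v w : 'rV['F_2]_n.

Definition triple u v w : 'F_2 := \sum_i u 0 i * v 0 i * w 0 i.

Lemma F2_indicator (a : 'F_2) : a = (a != 0)%:R.
Proof. by case: a => [[|[|//]] ?]; apply: val_inj. Qed.

Lemma common3_triple u v w : (common3 u v w)%:R = triple u v w.
Proof.
rewrite /common3 -sum1_card natr_sum big_mkcond; apply: eq_bigr => i _.
rewrite inE [u 0 i in RHS]F2_indicator [v 0 i in RHS]F2_indicator.
rewrite [w 0 i in RHS]F2_indicator -!natrM !mulnb -andbA.
by case: ifP => // ->.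
Qed.

Lemma tripleC12 u v w : triple u v w = triple v u w.
Proof. by apply: eq_bigr => i _; rewrite [u 0 i * _]mulrC. Qed.

Lemma tripleC23 u v w : triple u v w = triple u w v.
Proof. by apply: eq_bigr => i _; rewrite mulrAC. Qed.

Lemma tripleDl u u' v w : triple (u + u') v w = triple u v w + triple u' v w.
Proof.
by rewrite /triple -big_split; apply: eq_bigr => i _; rewrite mxE !mulrDl.
Qed.

(** The form is alternating on [C] because [u] and [w] overlap evenly. *)
Lemma doubly_even_triple (C : {vspace 'rV['F_2]_n}) u w :
  doubly_even C -> u \in C -> w \in C -> triple u u w = 0.
Proof.
move=> hC uC wC; rewrite -common3_triple.
have -> : common3 u u w = common2 u w.
  by apply: eq_card => i; rewrite !inE andbA andbb.
have [/dvdnP[k ->] _] := hC u w uC wC.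
by rewrite natrM (_ : 2%:R = 0) ?mulr0 //; apply: val_inj.
Qed.

End Triple.

Section Associator.
Variables (n : nat) (C : {vspace 'rV['F_2]_n}).
Hypothesis hC : doubly_even C.
Variable phi : subvs_of C -> subvs_of C -> 'F_2.
Hypothesis hphi : factor_set phi.
Local Notation T := (code_loop hphi).
Implicit Types x y z t : T.

(** Multiplication by the central element [(a, 0)]. *)
Definition shift (a : 'F_2) x : T := (a + x.1, x.2).

Definition assoc x y z : 'F_2 := triple (vsval x.2) (vsval y.2) (vsval z.2).

Lemma shift0 x : shift 0 x = x.
Proof. by case: x => a u; rewrite /shift add0r. Qed.

Lemma shiftD a b x : shift a (shift b x) = shift (a + b) x.
Proof. by rewrite /shift addrA. Qed.

Lemma code_mulE x y : (x * y)%g = (x.1 + y.1 + phi x.2 y.2, x.2 + y.2).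
Proof. by []. Qed.

Lemma shift_mulr a x y : (x * shift a y)%g = shift a (x * y)%g.
Proof. by rewrite !code_mulE /shift /= addrCA !addrA. Qed.

(** This is the cocycle condition on [phi], the signs being irrelevant in
characteristic 2. *)
Lemma code_mulA x y z : (x * y * z)%g = shift (assoc x y z) (x * (y * z))%g.
Proof.
rewrite !code_mulE /shift /assoc /= -common3_triple -(factor_set_assoc hphi).
congr pair; last by rewrite addrA.
(* What remains is an identity between seven elements of F_2. *)
set p := phi x.2 y.2; set q := phi (x.2 + y.2) z.2; set r := phi y.2 z.2.
set s := phi x.2 (y.2 + z.2).
by move: x.1 y.1 z.1 p q r s; do 7![case=> [[|[|//]] ?]]; apply: val_inj.
Qed.

(** Moving the brackets to the left is the same correction, as it is an
involution. *)
Lemma code_mulA_rev x y z : (x * (y * z))%g = shift (assoc x y z) (x * y * z)%g.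
Proof. by rewrite code_mulA shiftD addFF shift0. Qed.

Lemma assocC12 x y z : assoc x y z = assoc y x z.
Proof. exact: tripleC12. Qed.

Lemma assocC23 x y z : assoc x y z = assoc x z y.
Proof. exact: tripleC23. Qed.

Lemma assocMl x y z t : assoc (x * y)%g z t = assoc x z t + assoc y z t.
Proof. by rewrite /assoc code_mulE -tripleDl -linearD. Qed.

Lemma assocMr x y z t : assoc z t (x * y)%g = assoc z t x + assoc z t y.
Proof.
rewrite assocC23 assocC12 assocMl [assoc x z t]assocC12 [assoc y z t]assocC12.
by congr (_ + _); exact: assocC23.
Qed.

Lemma assocxx x y : assoc x x y = 0.
Proof. exact: doubly_even_triple hC (subvsP _) (subvsP _). Qed.

Lemma assocxyx x y : assoc x y x = 0.
Proof. by rewrite assocC23 assocxx. Qed.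

(** Both sides of the hypothesis have the same component in [C], so conjugate
elements do as well, and the associator does not distinguish them. *)
Lemma assoc_conj x y z s t : (z * x = x * y)%g -> assoc z s t = assoc y s t.
Proof.
move=> e; have := congr1 (fun r => assoc r s t) e.
by rewrite !assocMl addrC => /addrI.
Qed.

Lemma code_loop_LC : LC_loop T.
Proof.
move=> x y z.
rewrite [(x * (x * y))%g]code_mulA_rev assocxx shift0.
by rewrite [RHS]code_mulA assocMl addFF shift0.
Qed.

Lemma code_loop_RC : RC_loop T.
Proof.
move=> x y z; rewrite code_mulA assocMr addFF shift0.
by rewrite [(z * x * x)%g]code_mulA assocC12 assocC23 assocxx shift0.
Qed.

Lemma code_loop_Moufang : Moufang_loop T.
Proof.
move=> x y z.
rewrite [LHS]code_mulA [RHS]code_mulA [(y * z * x)%g]code_mulA shift_mulr shiftD.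
rewrite assocMr !assocxyx addr0 add0r.
by rewrite [assoc y z x]assocC23 [assoc y x z]assocC12.
Qed.

Lemma code_loop_extra : extra_loop T.
Proof.
move=> x y z; rewrite code_mulA [(x * y * (z * x))%g]code_mulA shiftD.
rewrite assocMl assocMr !assocxyx add0r addr0.
by rewrite [assoc y z x]assocC23 [assoc y x z]assocC12 addFF shift0.
Qed.

(** With [w = x t], the conjugate sends [w] to [x (y t)], and [z (x t)] is
[(z x) t] up to a central element; the witness [z] is the solution of
[z x = x y], which makes this [(x y) t].  The two associator corrections
agree by [assoc_conj]. *)
Lemma code_loop_LCC : LCC_loop T.
Proof.
move=> x y; exists (rdiv (x * y)%g x) => w; set z := rdiv _ _.
have ez : (z * x = x * y)%g by rewrite /z mulKrdiv.
rewrite /comp /ltrans /ltrans_inv -{2}(mulKldiv x w); set t := ldiv x w.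
rewrite [RHS]code_mulA_rev ez [(x * y * t)%g]code_mulA shiftD (assoc_conj _ _ ez).
by rewrite [assoc y x t]assocC12 addFF shift0.
Qed.

(** The mirror image: the witness solves [x z = y x]. *)
Lemma code_loop_RCC : RCC_loop T.
Proof.
move=> x y; exists (ldiv x (y * x)%g) => w; set z := ldiv _ _.
have ez : (x * z = y * x)%g by rewrite /z mulKldiv.
rewrite /comp /rtrans /rtrans_inv -{2}(mulKrdiv x w); set t := rdiv w x.
rewrite [RHS]code_mulA ez [LHS]code_mulA [assoc t y x]assocC12.
by rewrite (assoc_conj _ _ (esym ez)) [assoc z t x]assocC12 [assoc t z x]assocC23.
Qed.

End Associator.

Theorem theorem6p1 (n : nat) (C : {vspace 'rV['F_2]_n})
    (hC : doubly_even C) (phi : subvs_of C -> subvs_of C -> 'F_2)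
    (hphi : factor_set phi) :
  [/\ C_loop (code_loop hphi), CC_loop (code_loop hphi),
      Burn_loop (code_loop hphi) & extra_loop (code_loop hphi)].
Proof.
have hCC : CC_loop (code_loop hphi).
  by split; [apply: code_loop_LCC | apply: code_loop_RCC].
split=> //; last exact: code_loop_extra.
  by split; [apply: code_loop_LC | apply: code_loop_RC].
by split=> //; apply: code_loop_Moufang.
Qed.
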